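(* There exists an absolute constant $E_0$ such that for all positive integers $E,D$ with $E\ge E_0$ and $E\ge e^{9D}$, $$P(1,E,D)\ge 1-\frac{1}{\sqrt[4]{E}}.$$
   Context: A graph $\Gamma$ consists of a vertex set $V(\Gamma)$, a set $E(\Gamma)$ of (oriented) edges, a reverse map $e\mapsto\overline{e}$ on $E(\Gamma)$ with $\overline{e}\neq e$ and $\overline{\overline{e}}=e$, and an initial vertex map $\iota:E(\Gamma)\to V(\Gamma)$; the terminal vertex is $\tau(e)=\iota(\overline{e})$. A topological edge is a pair $\{e,\overline e\}$. Loops and multiple edges are allowed. A GBS graph is a pair $(\Gamma,\psi)$ with $\Gamma$ a finite graph and $\psi:E(\Gamma)\to\mathbb{Z}\setminus\{0\}$; $\psi(e)$ is the label on $e$ near $\tau(e)$. When $\Gamma$ is connected, the GBS group represented by $(\Gamma,\psi)$ is defined as follows. Choose a maximal tree $T=\overline{T}\subseteq E(\Gamma)$. The generators are $a_v$ for $v\in V(\Gamma)$ and $t_e$ for $e\in E(\Gamma)\setminus T$. The relations are: $a_{\iota(e)}^{\psi(\overline e)}=a_{\tau(e)}^{\psi(e)}$ for $e\in T$; and $t_{\overline e}=t_e^{-1}$ and $a_{\iota(e)}^{\psi(\overline e)}t_e=t_e a_{\tau(e)}^{\psi(e)}$ for $e\in E(\Gamma)\setminus T$. The isomorphism type does not depend on $T$. Fully reduced: a connected $(\Gamma,\psi)$ is fully reduced if there are no distinct vertices $v,u$ such that, in its GBS group, $a_v$ is conjugate to a power of $a_u$. Set of primes: $\mathcal{P}(\Gamma,\psi)$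 is the set of primes $r$ with $r\mid\psi(e)$ for some $e\in E(\Gamma)$. Minimal edge: $e\in E(\Gamma)$ is minimal if there is no $e'\in E(\Gamma)$ with $\tau(e')=\tau(e)$, $\psi(e')\mid\psi(e)$ and $\psi(e')\neq\pm\psi(e)$. Flexible: a connected $(\Gamma,\psi)$ is flexible if (1) it is fully reduced; (2) there is no $e\in E(\Gamma)$ such that both $e$ and $\overline e$ are minimal; (3) for every two distinct edges $e,e'\in E(\Gamma)$ with $\tau(e)=\tau(e')$, if $\psi(e)\mid\psi(e')$ then $\psi(e')/\psi(e)$ is a multiple of every prime in $\mathcal{P}(\Gamma,\psi)$. Random GBS graph with parameters $V,E,D,N$ (positive integers): fix a set $\{p_1,\dots,p_D\}$ of $D$ distinct primes (which one is irrelevant for flexibility). The vertex set is $[V]=\{1,\dots,V\}$. Let $v_1,\dots,v_{2E}$ be independent and uniform in $[V]$; the $E$ topological edges join $v_{2i-1}$ to $v_{2i}$, $i=1,\dots,E$ (a loop if these coincide; for $V=1$ all edges are loops). Independently of the graph, each of the $2E$ oriented edges $e_i$ receives the label $\psi(e_i)=(-1)^{\epsilon_i}\prod_{j=1}^D p_j^{\alpha_{i,j}}$, where all $\epsilon_i$ and $\alpha_{i,j}$ are independent, $\epsilon_i$ is uniform in $\{0,1\}$ and $\alpha_{i,j}$ is uniform in $\{0,1,\dots,N-1\}$. Let $p(V,E,D,N)\in[0,1]$ be the probability that a random GBS graph with parameters $V,E,D,N$ is flexible, and define $P(V,E,D):=\liminf_{N\to+\infty}p(V,E,D,N)$. *)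

(* Defs.v *)
From mathcomp Require Import all_boot all_order all_algebra.
From mathcomp Require Import all_classical all_reals all_analysis.

Set Implicit Arguments.
Unset Strict Implicit.
Unset Printing Implicit Defensive.

Import Order.TTheory GRing.Theory Num.Theory.
Local Open Scope ring_scope.

(* The letter [(x, false)] is the generator [x], and [(x, true)] is its formal
   inverse. *)
Definition word (X : Type) : Type := seq (X * bool).

Definition winv (X : Type) (w : word X) : word X :=
  rev [seq (x.1, ~~ x.2) | x <- w].

Definition gpow (X : Type) (x : X) (k : int) : word X :=
  nseq `|k|%N (x, k < 0).

(* Equality of the elements represented by two words in the group with
   generators [X] and relations [u = v] for all [u], [v] with [rels u v]. *)
Inductive pres_eq (X : Type) (rels : word X -> word X -> Prop) :
    word X -> word X -> Prop :=
  | pres_refl w : pres_eq rels w w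
  | pres_sym u v : pres_eq rels u v -> pres_eq rels v u
  | pres_trans u v w : pres_eq rels u v -> pres_eq rels v w -> pres_eq rels u w
  | pres_cat u u' v v' :
      pres_eq rels u u' -> pres_eq rels v v' -> pres_eq rels (u ++ v) (u' ++ v')
  | pres_cancel x b : pres_eq rels [:: (x, b); (x, ~~ b)] [::]
  | pres_rel u v : rels u v -> pres_eq rels u v.

(* The label [psi e] sits near the terminal vertex of [e]. *)
Record gbsGraph := GbsGraph {
  vert : finType;
  edge : finType;
  erev : edge -> edge;
  iota_ : edge -> vert;
  psi : edge -> int;
  erev_neq : forall e, erev e != e;
  erevK : involutive erev;
  psi_neq0 : forall e, psi e != 0
}.

Section GbsGraphTheory.
Variable G : gbsGraph.
Implicit Types (e f : edge G) (u v : vert G) (T : {set edge G}).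

Definition tau e : vert G := iota_ (erev e).

Definition adj T : rel (vert G) :=
  fun u v => [exists e in T, (iota_ e == u) && (tau e == v)].

Definition connected_graph : Prop := forall u v, connect (adj [set: edge G]) u v.

Definition circuit (c : seq (edge G)) : bool :=
  [&& c != [::],
      path.cycle (fun e f => (tau e == iota_ f) && (f != erev e)) c
    & uniq [seq iota_ e | e <- c]].

(* Subtrees are given by their edge sets; [set0] is the edge set of every
   subtree with a single vertex. *)
Definition subtree T : Prop :=
  [/\ forall e, e \in T -> erev e \in T,
      forall e f, e \in T -> f \in T -> connect (adj T) (iota_ e) (iota_ f)
    & forall c, circuit c -> ~ {subset c <= T}].

Definition maximal_tree T : Prop :=
  subtree T /\ forall T', subtree T' -> T \subset T' -> T' = T.

Inductive gbs_gen T : Type :=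
  | vgen of vert G
  | tgen of {e : edge G | e \notin T}.
Arguments vgen {T}.
Arguments tgen {T}.

Inductive gbs_rel T : word (gbs_gen T) -> word (gbs_gen T) -> Prop :=
  | gbs_rel_tree e : e \in T ->
      gbs_rel (gpow (vgen (iota_ e)) (psi (erev e))) (gpow (vgen (tau e)) (psi e))
  | gbs_rel_rev (e e' : {e : edge G | e \notin T}) : val e' = erev (val e) ->
      gbs_rel [:: (tgen e', false)] [:: (tgen e, true)]
  | gbs_rel_edge (e : {e : edge G | e \notin T}) :
      gbs_rel
        (gpow (vgen (iota_ (val e))) (psi (erev (val e))) ++ [:: (tgen e, false)])
        ((tgen e, false) :: gpow (vgen (tau (val e))) (psi (val e))).

Definition conj_to_power T v u : Prop :=
  exists (g : word (gbs_gen T)) (k : int),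
    pres_eq (@gbs_rel T) (winv g ++ [:: (vgen v, false)] ++ g) (gpow (vgen u) k).

(* The property does not depend on the maximal tree used to write down the
   presentation, and a maximal tree always exists. *)
Definition fully_reduced : Prop :=
  connected_graph /\
  forall T, maximal_tree T -> forall u v, u <> v -> ~ conj_to_power T v u.

Definition gbs_prime (r : nat) : Prop :=
  prime r /\ exists e, (r%:Z %| psi e)%Z.

Definition minimal_edge e : Prop :=
  ~ exists e', [/\ tau e' = tau e, (psi e' %| psi e)%Z,
                   psi e' <> psi e & psi e' <> - psi e].

Definition flexible : Prop :=
  [/\ fully_reduced,
      ~ (exists e, minimal_edge e /\ minimal_edge (erev e))
    & forall e e', e <> e' -> tau e = tau e' -> (psi e %| psi e')%Z ->
        forall r, gbs_prime r -> (r%:Z %| (psi e' %/ psi e)%Z)%Z].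

End GbsGraphTheory.

Record distinct_primes (D : nat) := DistinctPrimes {
  primes_val :> 'I_D -> nat;
  primes_prime : forall j, prime (primes_val j);
  primes_inj : injective primes_val
}.

(* The oriented edges [(i, false)] and [(i, true)] are the two orientations of
   the [i]-th topological edge. An outcome consists of the initial vertices of
   the [2E] oriented edges, and of their signs and exponents. *)
Definition outcome (V E D N : nat) : finType :=
  ({ffun 'I_E * bool -> 'I_V} * {ffun 'I_E * bool -> bool}
    * {ffun ('I_E * bool) * 'I_D -> 'I_N})%type.

Section RandomGbs.
Variables (V E D N : nat) (p : distinct_primes D) (w : outcome V E D N).

Definition random_rev (e : 'I_E * bool) : 'I_E * bool := (e.1, ~~ e.2).

Definition random_label (e : 'I_E * bool) : int :=
  (-1) ^+ w.1.2 e * \prod_(j < D) (p j)%:Z ^+ w.2 (e, j).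

Fact random_rev_neq e : random_rev e != e.
Proof. by case: e => i []; rewrite /random_rev xpair_eqE andbF. Qed.

Fact random_revK : involutive random_rev.
Proof. by case=> i b; rewrite /random_rev /= negbK. Qed.

Fact random_label_neq0 e : random_label e != 0.
Proof.
rewrite mulf_neq0 ?signr_eq0//; apply/prodf_neq0 => j _.
by rewrite expf_neq0// -lt0n prime_gt0// primes_prime.
Qed.

Definition random_gbs : gbsGraph :=
  @GbsGraph 'I_V ('I_E * bool)%type random_rev w.1.1 random_label
    random_rev_neq random_revK random_label_neq0.

End RandomGbs.

(* Independent uniform choices of the vertices, signs and exponents amount to a
   uniform choice in the finite product [outcome V E D N]. *)
Definition prob_flexible (R : realType) (V E D N : nat) (p : distinct_primes D) : R :=
  #|[set w : outcome V E D N | `[< flexible (random_gbs p w) >]]|%:R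
    / #|outcome V E D N|%:R.

(* The value at [N = 0], where there are no outcomes if [D] and [E] are
   positive, is irrelevant for the limit. *)
Definition liminf_flexible (R : realType) (V E D : nat) (p : distinct_primes D) : R :=
  limn_inf (fun N => prob_flexible R V E N p).

(* Main.v *)
Require Import Defs.
From mathcomp Require Import all_boot all_order all_algebra.
From mathcomp Require Import all_classical all_reals all_analysis.
From mathcomp Require Import ring lra.

Import Order.TTheory GRing.Theory Num.Theory.
Local Open Scope ring_scope.

(* A one-vertex graph is fully reduced, so only conditions (2) and (3) matter.
   The 2E labels are independent uniform exponent vectors in {0..N-1}^D, and for
   N large no two of them agree in any coordinate, up to probability O(1/N).
   Without such a collision, divisibility of labels is strict in every prime,
   which gives (3), and an edge is minimal iff its vector dominates no other.

   Let u(b) = prod_k (b_k + 1) / N be the proportion of vectors below b. Given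
   the vectors b, c of an edge and of its reverse, the remaining m = 2E - 2
   vectors all avoid the boxes below b and c with probability at most
   (1 - max(u(b), u(c)))^m <= 4 (m max(u(b), u(c)))^(-16/9)
                           <= 4 m^(-16/9) u(b)^(-8/9) u(c)^(-8/9).
   The mean of u^(-8/9) is at most 9^D since sum_(k <= N) k^(-8/9) <= 9 N^(1/9).
   So (2) fails with probability at most 4 E m^(-16/9) 81^D, which is at most
   4 E^(1 - 16/9 + 1/2) = 4 E^(-5/18), as 81^2 <= e^9. *)

(** * Divisibility of labels in terms of exponent vectors, and a criterion for flexibility *)

Section Labels.
Context {D : nat} (p : distinct_primes D).

Lemma primes_exp_gt0 k n : (0 < p k ^ n)%N.
Proof. by rewrite expn_gt0 prime_gt0 // Defs.primes_prime. Qed.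

Lemma logn_prod_primes (a : 'I_D -> nat) (j : 'I_D) :
  logn (p j) (\prod_(k < D) p k ^ a k)%N = a j.
Proof.
rewrite (bigD1 j) //= lognM ?primes_exp_gt0 ?prodn_cond_gt0 // => [|k _];
  last exact: primes_exp_gt0.
rewrite lognX logn_prime ?Defs.primes_prime // eqxx muln1 logn_coprime ?addn0 //.
apply: (big_ind (coprime (p j))) => [|m n|k kj].
- exact: coprimen1.
- by rewrite coprimeMr => -> ->.
rewrite coprimeXr // prime_coprime ?Defs.primes_prime // dvdn_prime2 ?Defs.primes_prime //.
by apply: contra kj => /eqP/primes_inj->.
Qed.

Lemma dvdn_prod_primes (a b : 'I_D -> nat) :
  (forall k, a k <= b k)%N ->
  (\prod_(k < D) p k ^ a k %| \prod_(k < D) p k ^ b k)%N.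
Proof.
move=> ab; apply: (big_ind2 (fun m n => m %| n)%N) => // [m n m' n'|k _].
  exact: dvdn_mul.
exact: dvdn_exp2l.
Qed.

Context {V E N : nat} (w : outcome V E D N).

Lemma abs_random_label e :
  `|random_label p w e|%N = (\prod_(k < D) p k ^ w.2 (e, k))%N.
Proof.
rewrite /random_label abszMsign.
rewrite (big_morph absz abszM (erefl _)).
by apply: eq_bigr => k _; rewrite abszX.
Qed.

Lemma random_label_dvd e e' :
  (random_label p w e %| random_label p w e')%Z =
  [forall k, (w.2 (e, k) <= w.2 (e', k))%N].
Proof.
rewrite dvdzE !abs_random_label.
apply/idP/forallP => [dv k|]; last exact: dvdn_prod_primes.
rewrite -(logn_prod_primes (fun k => w.2 (e, k)) k).
rewrite -(logn_prod_primes (fun k => w.2 (e', k)) k).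
apply: dvdn_leq_log => //.
by apply: prodn_gt0 => j; apply: primes_exp_gt0.
Qed.

(** Under this condition every weak inequality between exponents of distinct oriented edges is
    strict, at each prime separately. *)
Definition collision_free : Prop :=
  forall e e' k, e != e' -> w.2 (e, k) != w.2 (e', k).

Hypothesis free : collision_free.

(** The [p k]-adic valuation of the quotient is the difference of the two exponents, which is
    positive in the absence of collisions. *)
Lemma prime_dvd_random_quotient e e' k : e != e' ->
  (random_label p w e %| random_label p w e')%Z ->
  ((p k)%:Z %| (random_label p w e' %/ random_label p w e)%Z)%Z.
Proof.
move=> ee' dv; have := dv; rewrite random_label_dvd => /forallP/(_ k) le_k.
have lt_k : (w.2 (e, k) < w.2 (e', k))%N by rewrite ltn_neqAle le_k free.
have q_eq := divzK dv.
set q := (_ %/ _)%Z in q_eq *.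
have q0 : q != 0.
  apply/eqP => q0; move: q_eq; rewrite q0 mul0r => /esym/eqP.
  by rewrite (negPf (random_label_neq0 p w e')).
rewrite dvdzE.
have : (0 < logn (p k) `|q|)%N.
  have := congr1 absz q_eq; rewrite abszM !abs_random_label.
  move=> /(congr1 (logn (p k))); rewrite lognM ?absz_gt0 //; last first.
    by apply: prodn_gt0 => j; apply: primes_exp_gt0.
  rewrite !(logn_prod_primes (fun k => w.2 (_, k))) => h.
  by rewrite -(ltn_add2r (w.2 (e, k))) h add0n.
by rewrite logn_gt0 mem_primes => /and3P[].
Qed.

End Labels.

Lemma random_gbs_prime {V E D N} (p : distinct_primes D) (w : outcome V E D N) r :
  gbs_prime (random_gbs p w) r -> exists k, r = p k.
Proof.
case=> r_pr [e] /=; rewrite dvdzE abs_random_label Euclid_dvd_prod //.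
rewrite big_has => /hasP[k _]; rewrite Euclid_dvdX // => /andP[+ _].
by rewrite dvdn_prime2 ?Defs.primes_prime // => /eqP r_eq; exists k.
Qed.

(** All edges end at the same vertex, so a vector below that of [(i, b)] makes this orientation
    non-minimal. Taking [e] outside the topological edge [i] lets the count treat its vector as
    independent of the two vectors of [i]. *)
Lemma flexible_random_gbs {E D N} (p : distinct_primes D) (w : outcome 1 E D N) :
  (0 < D)%N -> collision_free w ->
  (forall i, exists2 e : 'I_E * bool, e.1 != i &
    exists b, [forall k, (w.2 (e, k) <= w.2 ((i, b), k))%N]) ->
  flexible (random_gbs p w).
Proof.
move=> D0 free dom; have one (u v : 'I_1) : u = v by rewrite !ord1.
split.
- split=> [u v|T _ u v uv]; first by rewrite (one u v) connect0.
  by case: uv; apply: one.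
- case=> -[i b] [min_e min_re].
  (* The dominating edge may lie below either orientation of [i], so minimality is restated for
     both. *)
  have {min_e min_re} min c : @minimal_edge (random_gbs p w) (i, c).
    move: min_e min_re; rewrite /= /random_rev /=.
    by case: b c => -[].
  have [e ei [c le_ec]] := dom i; apply: (min c); exists e.
  have e_ic : e != (i, c) by apply: contra ei => /eqP ->.
  have dv : (random_label p w e %| random_label p w (i, c))%Z.
    by rewrite random_label_dvd.
  have := prime_dvd_random_quotient p w free e (i, c) (Ordinal D0) e_ic dv.
  set q := (_ %/ _)%Z => pq; have q_eq : q * _ = _ := divzK dv.
  (* Taking [s] equal to 0 and 1 excludes the quotients 1 and -1; positivity of [D] supplies the
     prime. *)
  have ndv1 s : ~ ((p (Ordinal D0))%:Z %| ((-1) ^+ s)%R)%Z.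
    rewrite dvdzE abszX exp1n dvdn1 => /eqP p1.
    by have := prime_gt1 (Defs.primes_prime p (Ordinal D0)); rewrite -[p _]/`|p _|%N p1.
  split; [exact: one|exact: dv| |].
  + move=> /= eq_psi; apply: (ndv1 0%N); move: q_eq pq; rewrite -eq_psi.
    by rewrite -{2}[random_label p w e]mul1r => /(mulIf (random_label_neq0 p w e)) ->.
  + move=> /= eq_psi; apply: (ndv1 1%N); move: q_eq pq.
    rewrite (_ : random_label p w (i, c) = -1 * random_label p w e).
      by move=> /(mulIf (random_label_neq0 p w e)) ->.
    by rewrite mulN1r eq_psi opprK.
- move=> e e' /eqP ee' _ dv r /random_gbs_prime[k ->].
  exact: prime_dvd_random_quotient.
Qed.

(** * Counting tools: union bound, independence, and conditioning on two values *)

Lemma card_exists_le {I T : finType} (Q : I -> pred T) :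
  (#|[set x | [exists i, Q i x]]| <= \sum_i #|[set x | Q i x]|)%N.
Proof.
have -> : [set x | [exists i, Q i x]] = \bigcup_i [set x | Q i x].
  apply/setP => x; rewrite inE; apply/existsP/bigcupP => [[i Qi]|[i _ Qi]].
    by exists i; rewrite ?inE.
  by exists i; rewrite inE in Qi.
elim/big_rec2: _ => [|i n S _ le_Sn]; first by rewrite cards0.
by rewrite (leq_trans (leq_card_setU _ _)) // leq_add2l.
Qed.

Lemma card_set_snd {A B : finType} (Q : pred B) :
  #|[set w : A * B | Q w.2]| = (#|A| * #|[set b | Q b]|)%N.
Proof.
rewrite -cardsT -cardsX; apply: eq_card => w.
by rewrite !inE.
Qed.

(** Once the values at [y1] and [y2] are fixed, the other [#|Y| - 2] values range independently over
    one fixed set. *)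
Lemma card_ffun_pair {Y T : finType} (y1 y2 : Y) (P : rel T) (F : T -> T -> pred T) :
  y1 != y2 ->
  (#|[set f : {ffun Y -> T} | P (f y1) (f y2) &&
      [forall y, (y != y1) && (y != y2) ==> F (f y1) (f y2) (f y)]]| <=
    \sum_(b : T * T | P b.1 b.2) #|F b.1 b.2| ^ (#|Y| - 2))%N.
Proof.
move=> y12; rewrite -sum1_card.
rewrite (partition_big (fun f : {ffun Y -> T} => (f y1, f y2)) (fun b => P b.1 b.2));
  last by move=> f; rewrite inE => /andP[].
apply: leq_sum => -[b1 b2] /= _.
(* The fibre over [(b1, b2)] embeds in a product of sets, with singletons at [y1] and [y2]. *)
pose G y : pred T := if y == y1 then (pred1 b1 : pred T) else
  if y == y2 then (pred1 b2 : pred T) else F b1 b2.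
rewrite sum1_card (@leq_trans #|family G|) //.
  apply: subset_leq_card; apply/fintype.subsetP => f.
  rewrite unfold_in inE => /andP[/andP[_ /forallP Ff] /eqP[f1 f2]].
  apply/familyP => y; rewrite /G; case: eqVneq => [->|yy1]; first by rewrite inE f1.
  case: eqVneq => [->|yy2]; first by rewrite inE f2.
  by have /implyP := Ff y; rewrite yy1 yy2 f1 f2; apply.
rewrite card_family foldrE big_image /= (bigD1 y1) //= (bigD1 y2) 1?eq_sym //=.
rewrite {1 2}/G !eqxx (negPf (_ : y2 != y1)) 1?eq_sym // !card1 !mul1n.
rewrite (eq_bigr (fun=> #|F b1 b2|)) => [|y /andP[yy1 yy2]]; last first.
  by rewrite /G (negPf yy1) (negPf yy2).
rewrite prod_nat_const; apply: eq_leq; congr (_ ^ _)%N.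
have -> : 2%N = #|[set y1; y2]| by rewrite cards2 y12.
rewrite -cardsT -cardsDS ?finset.subsetT //; apply: eq_card => y; rewrite !inE.
by rewrite unfold_in negb_or andbT.
Qed.

(** * Vectors avoiding two boxes: moment and volume estimates *)

Section Undominated.
Context {R : realType}.

(** The bound telescopes: for [a] and [b] the ninth roots of [n + 1] and [n], 1 = a^9 - b^9 <= 9 a^8
    (a - b), hence a^(-8) <= 9 (a - b). *)
Lemma sum_powRN_le N :
  \sum_(k < N) (k.+1%:R : R) `^ (- (8 / 9)) <= 9 * N%:R `^ 9^-1.
Proof.
elim: N => [|n IH].
  by rewrite big_ord0 mulr_ge0 // powR_ge0.
rewrite big_ord_recr /= (le_trans (lerD IH (lexx _))) //.
set a := n.+1%:R `^ 9^-1; set b := n%:R `^ 9^-1.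
have a0 : 0 < a by rewrite powR_gt0.
have b0 : 0 <= b by rewrite powR_ge0.
have root9 (x : R) : 0 <= x -> (x `^ 9^-1) ^+ 9 = x.
  by move=> x0; rewrite -powR_mulrn ?powR_ge0 // -powRrM mulVf ?powRr1.
have ba : b <= a by rewrite ge0_ler_powR ?nnegrE ?ler_nat.
have -> : n.+1%:R `^ (- (8 / 9)) = a ^- 8.
  by rewrite powRN mulrC powRrM -powR_mulrn ?powR_ge0.
have ab : a ^+ 9 - b ^+ 9 = 1 by rewrite !root9 // -natrB // subSnn.
rewrite -lerBrDl -mulrBr -[X in X <= _]mul1r ler_pdivrMr ?exprn_gt0 // -[leLHS]ab.
rewrite subrXX -mulrA mulrCA ler_wpM2l ?subr_ge0 //.
rewrite mulr_natl -[X in _ *+ X](card_ord 9) -sumr_const ler_sum // => i _.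
rewrite -[X in _ <= a ^+ X](subnK (ltnSE (ltn_ord i))) exprD.
by rewrite ler_wpM2l ?exprn_ge0 ?(ltW a0) // lerXn2r ?nnegrE ?(ltW a0).
Qed.

Lemma sum_ratio_powRN_le N :
  \sum_(k < N) (k.+1%:R / N%:R : R) `^ (- (8 / 9)) <= 9 * N%:R.
Proof.
have [->|N0] := posnP N; first by rewrite big_ord0 mulr0.
under eq_bigr => k _ do rewrite powRM ?invr_ge0 //.
have -> : (N%:R^-1 : R) `^ (- (8 / 9)) = N%:R `^ (8 / 9).
  by rewrite -powR_inv1 // -powRrM mulN1r opprK.
rewrite -mulr_suml (le_trans (ler_wpM2r (powR_ge0 _ _) (sum_powRN_le N))) //.
rewrite -mulrA -powRD; last by rewrite pnatr_eq0 -lt0n N0 implybT.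
by rewrite (_ : 9^-1 + 8 / 9 = 1) ?powRr1 //; field.
Qed.

(* [(1 - u) ^+ m <= expR (- (m u))], and [y `^ (16 / 9) <= 1 + y ^+ 2 <= 4 expR y]. *)
Lemma expr_onem_le (u : R) m : 0 < u -> u <= 1 -> (0 < m)%N ->
  (1 - u) ^+ m <= 4 * (m%:R * u) `^ (- (16 / 9)).
Proof.
move=> u0 u1 m0; set y := m%:R * u; have y0 : 0 < y by rewrite mulr_gt0 ?ltr0n.
have le_exp : (1 - u) ^+ m <= (expR y)^-1.
  rewrite -expRN /y -mulrN mulrC expRM_natr lerXn2r ?nnegrE ?subr_ge0 ?expR_ge0 //.
  exact: expR_ge1Dx.
apply: (le_trans le_exp); rewrite powRN ler_pdivlMr ?powR_gt0 // mulrC.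
rewrite ler_pdivrMr ?expR_gt0 //.
have [y1|/ltW y1] := leP y 1.
  rewrite (@le_trans _ _ 1) //; last first.
    have := expR_ge1Dx y; lra.
  have one : (1 : R) `^ (16 / 9) = 1 by rewrite powR1.
  by rewrite -[leRHS]one ge0_ler_powR // nnegrE ltW.
rewrite (@le_trans _ _ (y ^+ 2)) //.
  by rewrite -powR_mulrn ?ler_powR ?(ltW y0) //; lra.
(* The constant 4 arises here: expR y = (expR (y / 2))^2 >= (1 + y / 2)^2 >= y^2 / 4. *)
have -> : y = y / 2 + y / 2 by field.
rewrite expRD; have := expR_ge1Dx (y / 2); nra.
Qed.

Context {D N : nat}.
Notation T := {ffun 'I_D -> 'I_N}.
Implicit Types b c : T.

Definition le_ffun b c : bool := [forall k, (b k <= c k)%N].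

Definition volume b : R := \prod_(k < D) ((b k).+1%:R / N%:R).

Lemma card_le_ffun c : (0 < N)%N -> #|[pred b | le_ffun b c]|%:R = volume c * (N ^ D)%:R.
Proof.
move=> N0; rewrite /volume big_split /= prodr_const card_ord exprVn -mulrA natrX.
rewrite mulVf ?mulr1 ?expf_neq0 ?pnatr_eq0 -?lt0n //.
rewrite -natr_prod; congr (_%:R).
rewrite (eq_card (B := family (fun k => [pred i : 'I_N | (i <= c k)%N]))) => [|b]; last first.
  by rewrite inE; apply: eq_forallb.
rewrite card_family foldrE big_image /=; apply: eq_bigr => k _.
by rewrite -[in LHS]sum1_card -(big_ord_widen N (fun=> 1%N) (ltn_ord (c k))) sum1_card card_ord.
Qed.

(** The power -8/9 of [volume], written coordinatewise so that its sum over all vectors factors into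
    [D] one-dimensional sums. *)
Definition weight b : R := \prod_(k < D) ((b k).+1%:R / N%:R) `^ (- (8 / 9)).

Lemma weightE b : weight b = volume b `^ (- (8 / 9)).
Proof.
rewrite /weight /volume.
elim: (index_enum _) => [|k s IH]; first by rewrite !big_nil powR1.
by rewrite !big_cons IH [RHS]powRM ?divr_ge0 ?prodr_ge0 // => i _; rewrite divr_ge0.
Qed.

Lemma weight_ge0 b : 0 <= weight b.
Proof. by rewrite weightE powR_ge0. Qed.

Lemma sum_weight_le : \sum_b weight b <= (9 * N%:R) ^+ D.
Proof.
rewrite -(bigA_distr_bigA (fun (_ : 'I_D) (i : 'I_N) =>
  (i.+1%:R / N%:R : R) `^ (- (8 / 9)))) prodr_const card_ord.
by rewrite lerXn2r ?nnegrE ?mulr_ge0 ?sumr_ge0 ?sum_ratio_powRN_le.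
Qed.

Definition undominated b1 b2 : pred T := [pred b | ~~ le_ffun b b1 && ~~ le_ffun b b2].

Hypothesis N0 : (0 < N)%N.

Lemma card_undominated_le b1 b2 m : (0 < m)%N ->
  (#|undominated b1 b2| ^ m)%:R <=
    4 * m%:R `^ (- (16 / 9)) * (weight b1 * weight b2) * ((N ^ D) ^ m)%:R.
Proof.
move=> m0; have ND0 : 0 < (N ^ D)%:R :> R by rewrite ltr0n expn_gt0 N0.
have volume_gt0 b : 0 < volume b.
  by rewrite prodr_gt0 // => k _; rewrite divr_gt0 ?ltr0n.
have volume_le1 b : volume b <= 1.
  by rewrite prodr_ile1 // => k _; rewrite divr_ge0 //= ler_pdivrMr ?ltr0n // mul1r ler_nat.
have fst_le b c : #|undominated b c|%:R / (N ^ D)%:R <= 1 - volume b.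
  rewrite ler_pdivrMr // mulrBl mul1r -card_le_ffun // lerBrDr -natrD ler_nat.
  rewrite -[X in (_ <= X ^ _)%N]card_ord -[X in (_ <= _ ^ X)%N]card_ord -card_ffun.
  rewrite -(cardC [pred b' | le_ffun b' b]) addnC leq_add2l subset_leq_card //.
  by apply/fintype.subsetP => d; rewrite !inE => /andP[].
have undomC b c : #|undominated b c| = #|undominated c b|.
  by apply: eq_card => d; rewrite !inE andbC.
(* By symmetry the box below [b2] is the larger one, and only its avoidance is used. *)
wlog le12 : b1 b2 / volume b1 <= volume b2 => [wl|].
  have [|/ltW] := leP (volume b1) (volume b2); first exact: wl.
  by move=> /wl; rewrite undomC [weight b2 * _]mulrC.
rewrite [leLHS]natrX [X in _ * X]natrX -ler_pdivrMr ?exprn_gt0 // -expr_div_n.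
rewrite (@le_trans _ _ ((1 - volume b2) ^+ m)) //.
  by rewrite lerXn2r ?nnegrE ?divr_ge0 ?subr_ge0 // undomC fst_le.
rewrite (le_trans (expr_onem_le (volume b2) m _ _ _)) //.
rewrite powRM ?(ltW (volume_gt0 _)) // mulrA ler_wpM2l ?mulr_ge0 ?powR_ge0 //.
(* One half of the power of [volume b2] is enlarged to the same power of the smaller [volume b1];
   the bound is then a product, and its sum over pairs factors. *)
have -> : - (16 / 9) = - (8 / 9) + - (8 / 9) :> R by field.
rewrite powRD ?(gt_eqF (volume_gt0 _)) ?implybT // -!weightE ler_wpM2r ?weight_ge0 //.
by rewrite !weightE !powRN lef_pV2 ?posrE ?powR_gt0 // ge0_ler_powR ?nnegrE ?(ltW (volume_gt0 _)).
Qed.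

(** Summing over the values at [x1] and [x2] gives the square of the total weight, at most 81^D
    N^(2D); the power of [N] restores the two coordinates missing from [#|X| - 2]. *)
Lemma card_undominated_pair_le {X : finType} (x1 x2 : X) :
  x1 != x2 -> (2 < #|X|)%N ->
  #|[set f : {ffun X -> T} | [forall x,
      (x != x1) && (x != x2) ==> undominated (f x1) (f x2) (f x)]]|%:R <=
    4 * (#|X| - 2)%:R `^ (- (16 / 9)) * 81 ^+ D * ((N ^ D) ^ #|X|)%:R :> R.
Proof.
move=> x12 X2; have m0 : (0 < #|X| - 2)%N by rewrite subn_gt0.
have le_card := card_ffun_pair x1 x2 (fun _ _ => true) undominated x12.
rewrite -(ler_nat R) in le_card; apply: (le_trans le_card).
rewrite natr_sum.
apply: le_trans (_ : _ <= \sum_(b : T * T) 4 * (#|X| - 2)%:R `^ (- (16 / 9)) *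
    (weight b.1 * weight b.2) * ((N ^ D) ^ (#|X| - 2))%:R) _.
  by apply: ler_sum => b _; apply: card_undominated_le.
rewrite -mulr_suml -mulr_sumr -(pair_bigA _ (fun b1 b2 => weight b1 * weight b2)) /=.
rewrite -big_distrlr /= -2![leLHS]mulrA -2![leRHS]mulrA. rewrite ler_wpM2l //.
rewrite ler_wpM2l ?powR_ge0 //.
have S0 : 0 <= \sum_b weight b by rewrite sumr_ge0 // => b _; apply: weight_ge0.
rewrite (@le_trans _ _ ((9 * N%:R) ^+ D * (9 * N%:R) ^+ D * ((N ^ D) ^ (#|X| - 2))%:R)) //.
  by apply: ler_wpM2r => //; apply: ler_pM => //; apply: sum_weight_le.
rewrite -{2}(subnK (ltnW X2)) addnC expnD natrM mulrA ler_wpM2r //.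
by rewrite !natrX -exprMn mulrACA -natrM exprMn -exprM mulnC exprM.
Qed.

End Undominated.

(** * Counting the bad outcomes for a fixed [N] *)

Lemma card_eq_pair_le {Y T : finType} (y1 y2 : Y) : y1 != y2 ->
  (#|[set f : {ffun Y -> T} | f y1 == f y2]| * #|T| <= #|{ffun Y -> T}|)%N.
Proof.
move=> y12; have Y2 : (1 < #|Y|)%N.
  by rewrite (leq_trans _ (max_card [set y1; y2])) // cards2 y12.
have := card_ffun_pair y1 y2 eq_op (fun _ _ => predT : pred T) y12.
rewrite (eq_card (B := [set f : {ffun Y -> T} | f y1 == f y2])) => [|f]; last first.
  rewrite !inE; case: eqP => //= _; apply/forallP => y; exact: implybT.
move=> le_card; rewrite (leq_trans (leq_mul le_card (leqnn _))) //.
rewrite -(pair_big_dep predT (fun b1 b2 : T => b1 == b2) (fun _ _ => #|T| ^ (#|Y| - 2))%N) /=.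
under eq_bigr => b _.
  under eq_bigl => c do rewrite eq_sym.
  rewrite big_pred1_eq; over.
rewrite sum_nat_const card_ffun -{2}(subnKC Y2) expnD mulnAC.
by rewrite expnS expn1.
Qed.

(** Currying: the sampled exponents become one vector per oriented edge, as the box estimates
    require. Injectivity transfers the counts. *)
Definition exponents {X : finType} {D N} (a : {ffun X * 'I_D -> 'I_N}) :
  {ffun X -> {ffun 'I_D -> 'I_N}} := [ffun x => [ffun k => a (x, k)]].

Lemma exponents_inj {X : finType} {D N} : injective (@exponents X D N).
Proof.
move=> a b /ffunP ab; apply/ffunP => -[x k].
by have /ffunP/(_ k) := ab x; rewrite !ffunE.
Qed.

Section Probability.
Context {R : realType} {E D N : nat} (p : distinct_primes D).
Hypotheses (E2 : (1 < E)%N) (D0 : (0 < D)%N) (N0 : (0 < N)%N).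
Notation X := ('I_E * bool)%type.
Notation outcomes := (outcome 1 E D N).

Definition collides (t : X * X * 'I_D) (a : {ffun X * 'I_D -> 'I_N}) : bool :=
  (t.1.1 != t.1.2) && (a (t.1.1, t.2) == a (t.1.2, t.2)).

Definition both_undominated (i : 'I_E) (a : {ffun X * 'I_D -> 'I_N}) : bool :=
  [forall x, (x != (i, false)) && (x != (i, true)) ==>
    undominated (exponents a (i, false)) (exponents a (i, true)) (exponents a x)].

Lemma not_flexible_random_gbs (w : outcomes) : ~ flexible (random_gbs p w) ->
  [exists t, collides t w.2] || [exists i, both_undominated i w.2].
Proof.
move=> nflex; apply/orP.
have [|free] := boolP [exists t, collides t w.2]; first by left.
right; apply/existsP; apply: contrapT => dom; apply: nflex.
apply: flexible_random_gbs => // [x y k xy|i].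
  apply: contra free => eq_xy; apply/existsP; exists (x, y, k).
  by rewrite /collides /= xy.
apply: contrapT => ndom; apply: dom; exists i; apply/forallP => x; apply/implyP.
move=> /andP[x0 x1]; have xi : x.1 != i.
  apply/eqP => xi; move: x x0 x1 xi => [j []] /= + + ji; rewrite ji ?eqxx //.
have nle b : ~~ le_ffun (exponents w.2 x) (exponents w.2 (i, b)).
  apply/negP => /forallP le; apply: ndom; exists x => //; exists b.
  by apply/forallP => k; have := le k; rewrite !ffunE.
by rewrite /undominated /= !nle.
Qed.

Lemma card_collides_le t :
  (#|[set w : outcomes | collides t w.2]| * N <= #|outcomes|)%N.
Proof.
rewrite card_set_snd [#|outcomes|]card_prod -mulnA leq_mul2l; apply/orP; right.
case: t => -[x y] k; have [->|xy] := eqVneq x y.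
  by rewrite (eq_card0 (A := [set b | _])) ?mul0n // => a; rewrite inE /collides eqxx.
rewrite -[X in (_ * X <= _)%N]card_ord.
have xyk : (x, k) != (y, k) by rewrite xpair_eqE eqxx andbT.
rewrite (leq_trans _ (card_eq_pair_le _ _ xyk)) // leq_mul2r subset_leq_card ?orbT //.
by apply/fintype.subsetP => a; rewrite !inE => /andP[].
Qed.

Lemma card_both_undominated_le i :
  #|[set w : outcomes | both_undominated i w.2]|%:R <=
    4 * (E * 2 - 2)%:R `^ (- (16 / 9)) * 81 ^+ D * #|outcomes|%:R :> R.
Proof.
have cardX : #|{: X}| = (E * 2)%N by rewrite card_prod card_ord card_bool.
have X2 : (2 < #|{: X}|)%N by rewrite cardX (@leq_trans (2 * 2)) // leq_mul2r E2.
have i01 : (i, false) != (i, true) by rewrite xpair_eqE andbF.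
have := @card_undominated_pair_le R D N N0 _ _ _ i01 X2.
set S := [set f | _] => le_S.
rewrite card_set_snd [#|outcomes|]card_prod !natrM mulrCA ler_wpM2l //.
have -> : #|{ffun X * 'I_D -> 'I_N}| = ((N ^ D) ^ #|{: X}|)%N.
  by rewrite card_ffun card_prod cardX !card_ord mulnC expnM.
rewrite -cardX; apply: le_trans le_S; rewrite ler_nat -(card_imset _ exponents_inj).
apply: subset_leq_card; apply/fintype.subsetP => _ /imsetP[a + ->].
by rewrite !inE.
Qed.

(** Union bound over the [E] topological edges and over the (2E)^2 D possible collisions, each of
    the latter having probability at most 1/N. *)
Lemma prob_flexible_ge :
  1 - (E%:R * (4 * (E * 2 - 2)%:R `^ (- (16 / 9)) * 81 ^+ D) +
       (E * 2 * (E * 2) * D)%:R / N%:R) <= prob_flexible R 1 E N p.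
Proof.
rewrite /prob_flexible; set S := [set w | _].
set q := 4 * _ * _.
have out0 : 0 < #|outcomes|%:R :> R.
  rewrite ltr0n !card_prod !card_ffun !card_ord !muln_gt0 !expn_gt0 N0 /=.
  by rewrite card_bool.
have N0R : 0 < N%:R :> R by rewrite ltr0n.
have SC : #|S|%:R = #|outcomes|%:R - #|~: S|%:R :> R by rewrite -(cardsC S) natrD addrK.
rewrite SC mulrBl divff ?gt_eqF // lerD2l lerN2 ler_pdivrMr // mulrDl.
pose B1 := [set w : outcomes | [exists i, both_undominated i w.2]].
pose B2 := [set w : outcomes | [exists t, collides t w.2]].
have /subset_leq_card le_SC : ~: S \subset B1 :|: B2.
  apply/fintype.subsetP => w; rewrite !inE => /asboolPn/not_flexible_random_gbs.
  by rewrite orbC.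
have {le_SC} le_SC := leq_trans le_SC (leq_card_setU _ _).
rewrite -(ler_nat R) natrD in le_SC; apply: (le_trans le_SC); apply: lerD.
  have le_B1 := card_exists_le (fun i (w : outcomes) => both_undominated i w.2).
  rewrite -(ler_nat R) natr_sum in le_B1; apply: (le_trans le_B1).
  apply: (@le_trans _ _ (\sum_(i < E) q * #|outcomes|%:R)).
    by apply: ler_sum => i _; apply: card_both_undominated_le.
  by rewrite sumr_const card_ord -[leLHS]mulr_natl mulrA.
rewrite mulrAC ler_pdivlMr // -!natrM ler_nat.
have le_B2 := card_exists_le (fun t (w : outcomes) => collides t w.2).
rewrite (leq_trans (leq_mul le_B2 (leqnn N))) //.
rewrite big_distrl /=.
apply: (@leq_trans (\sum_(t : X * X * 'I_D) #|outcomes|)).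
  by apply: leq_sum => t _; apply: card_collides_le.
by rewrite sum_nat_const !card_prod !card_ord card_bool.
Qed.

End Probability.

(** * Passage to the limit inferior, numerical constants, and the conclusion *)

Lemma limn_inf_ge {R : realType} (u : R^nat) (b : R) (n0 : nat) :
  bounded_fun u -> (forall n, (n0 <= n)%N -> b <= u n) -> b <= limn_inf u.
Proof.
move=> bu le_bu; rewrite limn_infE //.
(* The limit inferior is the supremum of the tail infima, so the single tail from [n0] suffices. *)
apply: (@le_trans _ _ (infs u n0)).
  apply: lb_le_inf; first by exists (u n0), n0 => /=.
  by move=> _ [n /= n0n <-]; apply: le_bu.
by apply: ub_le_sup; [exact: bounded_fun_has_ubound_infs|exists n0].
Qed.

Lemma prob_flexible_bounded {R : realType} V E D (p : distinct_primes D) :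
  bounded_fun (fun N => prob_flexible R V E N p).
Proof.
have ratio_le1 k n : (k <= n)%N -> `|k%:R / n%:R : R| <= 1.
  move=> kn; rewrite ger0_norm ?divr_ge0 //.
  (* With an empty outcome space the quotient is 0, by the convention for division by zero. *)
  have [->|n0] := posnP n; first by rewrite invr0 mulr0.
  by rewrite ler_pdivrMr ?ltr0n // mul1r ler_nat.
exists 1; split=> // M M1 N _; apply: le_trans (ltW M1).
by apply: ratio_le1; apply: max_card.
Qed.

(** Indeed e >= (1 + 1/32)^32 >= 2.66, and 2.66^9 exceeds 81^2 = 6561. *)
Lemma expR9_ge {R : realType} : 81 ^+ 2 <= expR 9 :> R.
Proof.
have e32 : (1 + 32^-1) ^+ 32 <= expR 1 :> R.
  rewrite (_ : expR 1 = expR 32^-1 ^+ 32 :> R); last by rewrite -expRM_natr mulVf.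
  by rewrite lerXn2r ?nnegrE ?expR_ge0 ?expR_ge1Dx // addr_ge0.
have sqr_le (a b x : R) n : 0 <= a -> b <= a ^+ 2 -> a <= x ^+ n -> b <= x ^+ (n * 2).
  move=> a0 ba ax; rewrite exprM (le_trans ba) // lerXn2r ?nnegrE //.
  exact: le_trans ax.
have {e32} e266 : 266 / 100 <= expR 1 :> R.
  apply: le_trans e32.
  (* Each decimal is slightly above the square root of the preceding one, so only small powers are
     computed. *)
  apply: (sqr_le (1634 / 1000) _ _ 16); [lra|lra|].
  apply: (sqr_le (12786 / 10000) _ _ 8); [lra|lra|].
  apply: (sqr_le (11308 / 10000) _ _ 4); [lra|lra|].
  apply: (sqr_le (10634 / 10000) _ _ 2); lra.
have -> : expR 9 = expR 1 ^+ 9 :> R by rewrite -expRM_natr mul1r.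
apply: (@le_trans _ _ ((266 / 100) ^+ 9)); last first.
  by rewrite lerXn2r ?nnegrE ?expR_ge0 // divr_ge0.
by rewrite (exprM _ 3 3); lra.
Qed.

(** The left side is at most 4 E^(-5/18), and 5/18 - 1/4 = 1/36, so what remains is 4 E^(-1/36) <=
    1/2. This holds from E = 8^36 = 2^108 on. The other half of the error is left to the
    collisions. *)
Lemma tail_le {R : realType} (E D : nat) :
  (2 ^ 108 <= E)%N -> expR (9 * D%:R) <= E%:R :> R ->
  E%:R * (4 * (E * 2 - 2)%:R `^ (- (16 / 9)) * 81 ^+ D) <= 2^-1 / E%:R `^ (1 / 4) :> R.
Proof.
rewrite -(ler_nat R) natrX => E108 DE.
set e : R := E%:R in E108 DE *.
have e1 : 1 <= e by rewrite (le_trans _ E108) // exprn_ege1 // ler1n.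
have e0 : 0 < e by apply: lt_le_trans e1.
have le81 : 81 ^+ D <= e `^ (1 / 2).
  rewrite div1r powR12_sqrt ?(ltW e0) // -(ler_pXn2r (n := 2)) ?nnegrE ?sqrtr_ge0 ?exprn_ge0 //.
  rewrite sqr_sqrtr ?(ltW e0) // (le_trans _ DE) // mulrC expRM_natl -exprM mulnC exprM.
  by rewrite lerXn2r ?nnegrE ?expR_ge0 ?exprn_ge0 // expR9_ge.
have lem : (E * 2 - 2)%:R `^ (- (16 / 9)) <= e `^ (- (16 / 9)).
  have E1 : (1 < E)%N by rewrite -(ltr_nat R) (lt_le_trans _ E108) // -natrX ltr_nat.
  have leE : (E <= E * 2 - 2)%N by rewrite muln2 -addnn -addnBA // leq_addr.
  rewrite !powRN lef_pV2 ?posrE ?powR_gt0 // ?ltr0n ?(leq_trans _ leE) // ?(ltnW E1) //.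
  by rewrite ge0_ler_powR ?nnegrE // ler_nat.
have le8 : 8 <= e `^ (1 / 36).
  have -> : 8 = (2 ^+ 108) `^ (1 / 36) :> R.
    rewrite (exprM _ 3 36) -(@powR_mulrn _ (2 ^+ 3) 36) ?exprn_ge0 // -powRrM.
    by rewrite div1r mulfV ?pnatr_eq0 // powRr1 //; lra.
  by rewrite ge0_ler_powR ?nnegrE // ltW.
have powD r s : e `^ (r + s) = e `^ r * e `^ s by rewrite powRD // (gt_eqF e0) implybT.
rewrite ler_pdivlMr ?powR_gt0 //.
apply: (@le_trans _ _ (e * (4 * e `^ (- (16 / 9)) * e `^ (1 / 2)) * e `^ (1 / 4))).
  rewrite ler_wpM2r ?powR_ge0 // ler_wpM2l ?(ltW e0) // ler_pM ?mulr_ge0 ?powR_ge0 //.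
  by rewrite ler_wpM2l.
have -> : e * (4 * e `^ (- (16 / 9)) * e `^ (1 / 2)) * e `^ (1 / 4) = 4 * e `^ (- (1 / 36)).
  rewrite -{1}(powRr1 (ltW e0)).
  have -> : - (1 / 36) = 1 + (- (16 / 9) + 1 / 2) + 1 / 4 :> R by field.
  by rewrite !powD; ring.
rewrite powRN ler_pdivrMr ?powR_gt0 //; lra.
Qed.

Theorem theorem3 (R : realType) :
  exists E0 : nat, forall (E D : nat),
    (0 < E)%N -> (0 < D)%N -> (E0 <= E)%N -> expR (9 * D%:R) <= E%:R :> R ->
    forall p : distinct_primes D,
      1 - 1 / (E%:R `^ (1 / 4)) <= liminf_flexible R 1 E p.
Proof.
exists (2 ^ 108)%N => E D E0 D0 E108 DE p.
have E1 : (1 < E)%N by rewrite (leq_trans _ (leq_trans (ltnW (ltn_expl 108 (isT : 1 < 2)%N)) E108)).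
move: (tail_le _ _ E108 DE) => {E108 DE}.
set c := E%:R `^ (1 / 4); have c0 : 0 < c by apply: powR_gt0; rewrite ltr0n.
rewrite -/c => le_tail.
pose K := (E * 2 * (E * 2) * D)%N.
(* From this index on, N >= 2 K c, so the collision term K / N is at most 1 / (2 c); the successor
   keeps [N] positive. *)
apply: (limn_inf_ge _ _ (Num.bound (2 * K%:R * c)).+1); first exact: prob_flexible_bounded.
move=> N leN; have N0 : (0 < N)%N by apply: leq_trans leN.
apply: le_trans (prob_flexible_ge p E1 D0 N0); rewrite lerD2l lerN2.
apply: (le_trans (lerD le_tail (_ : _ <= 2^-1 / c))); last by rewrite -mulrDl; lra.
rewrite ler_pdivrMr ?ltr0n // mulrAC ler_pdivlMr // -/K.
have := archi_boundP (_ : 0 <= 2 * K%:R * c).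
have : (Num.bound (2 * K%:R * c))%:R <= N%:R :> R by rewrite ler_nat ltnW.
have : 0 <= 2 * K%:R * c by rewrite !mulr_ge0 // ltW.
move=> h1 h2 /(_ h1) h3; lra.
Qed.
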